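(* Let $Q$ be a uniquely $6$-divisible Moufang loop (not necessarily finite) whose inner mapping group $\mathrm{Inn}(Q)$ is abelian. Then $Q$ is nilpotent of nilpotency class at most $2$.
   Context: A loop is a set $Q$ with a binary operation (written as juxtaposition) and a two-sided neutral element $1$ such that all left translations $L_x:Q\to Q$, $yL_x=xy$, and all right translations $R_x:Q\to Q$, $yR_x=yx$, are bijections. Mappings are written on the right of their arguments and composed from left to right. The inner mapping group $\mathrm{Inn}(Q)$ is the permutation group on $Q$ generated by all $T(x)=R_xL_x^{-1}$, $L(x,y)=L_xL_yL_{yx}^{-1}$ and $R(x,y)=R_xR_yR_{xy}^{-1}$ with $x,y\in Q$. The center is $Z(Q)=\{x\in Q : x\varphi=x \text{ for every } \varphi\in\mathrm{Inn}(Q)\}$. The iterated centra are $Z_0(Q)=1$, $Z_{i+1}(Q)/Z_i(Q)=Z(Q/Z_i(Q))$, and $Q$ is nilpotent of class $m$ if $m$ is the least integer with $Z_m(Q)=Q$. A loop is Moufang if it satisfies the identity $x(y(xz))=((xy)x)z$; Moufang loops are power-associative, so powers are well defined. For an integer $m>1$, a loop $Q$ is uniquely $m$-divisible if for every $x\in Q$ there is a unique $y\in Q$ with $y^m=x$. *)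

(* Defs.v *)
From HB Require Import structures.
From mathcomp Require Import all_boot.
From mathcomp Require Import boolp classical_sets.

Set Implicit Arguments.
Unset Strict Implicit.
Unset Printing Implicit Defensive.

Local Open Scope classical_set_scope.
Local Open Scope group_scope.

(** ** Permutation groups on an arbitrary (possibly infinite) type *)

(* A set of bijections containing the identity and closed under composition
   and inverses. *)
Definition perm_group (T : Type) (G : set (T -> T)) : Prop :=
  [/\ forall f, G f -> bijective f,
      G idfun,
      forall f g, G f -> G g -> G (f \; g)
    & forall f g, G f -> cancel f g -> cancel g f -> G g].

Definition generated_perm_group (T : Type) (S : set (T -> T)) : set (T -> T) :=
  smallest (@perm_group T) S.

Definition commuting (T : Type) (G : set (T -> T)) : Prop :=
  forall f g, G f -> G g -> f \; g = g \; f.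

Lemma bijective_inverse (T : Type) (f : T -> T) :
  bijective f -> {g : T -> T | cancel f g /\ cancel g f}.
Proof. by move=> bijf; apply: cid; case: bijf => g fK gK; exists g. Qed.

Definition inverse (T : Type) (f : T -> T) (bijf : bijective f) : T -> T :=
  sval (bijective_inverse bijf).

Lemma inverseK (T : Type) (f : T -> T) (bijf : bijective f) :
  cancel f (inverse bijf).
Proof. by rewrite /inverse; case: bijective_inverse => g []. Qed.

Lemma inverseVK (T : Type) (f : T -> T) (bijf : bijective f) :
  cancel (inverse bijf) f.
Proof. by rewrite /inverse; case: bijective_inverse => g []. Qed.

(** ** Loops *)

(* [UMagma] requires a choice structure on the carrier; with the axioms of
   [boolp] every type has one, so this does not restrict the class of loops. *)
HB.mixin Record UMagma_isLoop Q of UMagma Q := {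
  bij_mulgl : forall x : Q, bijective (fun y => x * y);
  bij_mulgr : forall x : Q, bijective (fun y => y * x)
}.

#[short(type="loopType")]
HB.structure Definition Loop := {Q of UMagma_isLoop Q & UMagma Q}.

Definition Ltrans (Q : loopType) (x : Q) : Q -> Q := fun y => x * y.
Definition Rtrans (Q : loopType) (x : Q) : Q -> Q := fun y => y * x.
Definition LtransV (Q : loopType) (x : Q) : Q -> Q := inverse (bij_mulgl x).
Definition RtransV (Q : loopType) (x : Q) : Q -> Q := inverse (bij_mulgr x).

(* [f \; g] is composition from left to right. *)
Definition inn_T (Q : loopType) (x : Q) : Q -> Q := Rtrans x \; LtransV x.
Definition inn_L (Q : loopType) (x y : Q) : Q -> Q :=
  Ltrans x \; Ltrans y \; LtransV (y * x).
Definition inn_R (Q : loopType) (x y : Q) : Q -> Q :=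
  Rtrans x \; Rtrans y \; RtransV (x * y).

Definition inn_generators (Q : loopType) : set (Q -> Q) :=
  [set f | [\/ exists x, f = inn_T x,
               exists x y, f = inn_L x y
             | exists x y, f = inn_R x y]].
Arguments inn_generators : clear implicits.

Definition Inn (Q : loopType) : set (Q -> Q) :=
  generated_perm_group (inn_generators Q).
Arguments Inn : clear implicits.

Definition center (Q : loopType) : set Q :=
  [set x | forall phi, Inn Q phi -> phi x = x].
Arguments center : clear implicits.

(** ** Elementary facts on inner mappings and the center *)

Section LoopTheory.
Variable Q : loopType.
Implicit Types x y z a b : Q.

Lemma mulgI x : injective (mul x).
Proof. exact: bij_inj (bij_mulgl x). Qed.

Lemma mulIg x : injective (mul^~ x).
Proof. exact: bij_inj (bij_mulgr x). Qed.

Lemma LtransVK x y : x * LtransV x y = y.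
Proof. exact: (inverseVK (bij_mulgl x)). Qed.

Lemma RtransVK x y : RtransV x y * x = y.
Proof. exact: (inverseVK (bij_mulgr x)). Qed.

Lemma inn_TE x z : x * inn_T x z = z * x.
Proof. exact: LtransVK. Qed.

Lemma inn_LE x y z : (y * x) * inn_L x y z = y * (x * z).
Proof. exact: LtransVK. Qed.

Lemma inn_RE x y z : inn_R x y z * (x * y) = (z * x) * y.
Proof. exact: RtransVK. Qed.

Lemma bij_LtransV x : bijective (LtransV x).
Proof. by exists (mul x); [exact: inverseVK | exact: inverseK]. Qed.

Lemma bij_RtransV x : bijective (RtransV x).
Proof. by exists (mul^~ x); [exact: inverseVK | exact: inverseK]. Qed.

Lemma inn_generators_bij f : inn_generators Q f -> bijective f.
Proof.
move=> [[x ->]|[x [y ->]]|[x [y ->]]].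
- exact: bij_comp (bij_LtransV x) (bij_mulgr x).
- exact: bij_comp (bij_comp (bij_LtransV _) (bij_mulgl y)) (bij_mulgl x).
- exact: bij_comp (bij_comp (bij_RtransV _) (bij_mulgr y)) (bij_mulgr x).
Qed.

Lemma perm_group_bijective (T : Type) : perm_group (@bijective T T).
Proof.
split=> //; first by exists idfun.
- by move=> f g bf bg; exact: bij_comp bg bf.
- by move=> f g _ fK gK; exists f.
Qed.

Lemma InnP : perm_group (Inn Q).
Proof.
split.
- apply: smallest_sub; first exact: perm_group_bijective.
  by move=> f /inn_generators_bij.
- by move=> A [[_ A1 _ _] _].
- by move=> f g If Ig A [pA gA]; case: (pA) => _ _ AM _;
    apply: AM; [apply: If|apply: Ig].
- by move=> f g If fK gK A [pA gA]; case: (pA) => _ _ _; apply; last 2 first;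
    [exact: fK|exact: gK|apply: If].
Qed.

Lemma inn_T_in x : Inn Q (inn_T x).
Proof. by apply: sub_gen_smallest; apply: Or31; exists x. Qed.

Lemma inn_L_in x y : Inn Q (inn_L x y).
Proof. by apply: sub_gen_smallest; apply: Or32; exists x, y. Qed.

Lemma inn_R_in x y : Inn Q (inn_R x y).
Proof. by apply: sub_gen_smallest; apply: Or33; exists x, y. Qed.

Lemma inn_inv phi : Inn Q phi ->
  exists psi, [/\ Inn Q psi, cancel phi psi & cancel psi phi].
Proof.
case: InnP => Ib _ _ IV Iphi; case: (Ib _ Iphi) => psi fK gK.
by exists psi; split=> //; apply: IV fK gK.
Qed.

Lemma perm_group_stab (T : Type) (x : T) :
  perm_group [set f : T -> T | bijective f /\ f x = x].
Proof.
split=> [f []//||f g [bf fx] [bg gx]|f g [bf fx] fK gK].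
- by split=> //; exists idfun.
- by split; [exact: bij_comp bg bf|rewrite /= fx gx].
- by split; [exists f|rewrite -{1}fx fK].
Qed.

Lemma centerP x : center Q x <->
  [/\ forall a, x * a = a * x,
      forall a b, b * (a * x) = (b * a) * x
    & forall a b, (x * a) * b = x * (a * b)].
Proof.
split=> [Zx|[xC xL xR]].
  split=> [a|a b|a b].
  - by rewrite -inn_TE (Zx _ (inn_T_in a)).
  - by rewrite -inn_LE (Zx _ (inn_L_in a b)).
  - by rewrite -inn_RE (Zx _ (inn_R_in a b)).
move=> phi Iphi.
suff [] : [set f : Q -> Q | bijective f /\ f x = x] phi by [].
apply: Iphi; split; first exact: perm_group_stab.
move=> f gf; split; first exact: inn_generators_bij.
case: gf => [[a ->]|[a [b ->]]|[a [b ->]]].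
- by apply: (@mulgI a); rewrite inn_TE xC.
- by apply: (@mulgI (b * a)); rewrite inn_LE xL.
- by apply: (@mulIg (a * b)); rewrite /= inn_RE xR.
Qed.

Lemma center1 : center Q 1.
Proof. by apply/centerP; split=> *; rewrite ?mulg1 ?mul1g. Qed.

Lemma centerM x y : center Q x -> center Q y -> center Q (x * y).
Proof.
move=> /centerP[xC xL xR] /centerP[yC yL yR]; apply/centerP.
split=> [a|a b|a b].
- by rewrite xR yC !yL xC.
- by rewrite !yL xL.
- by rewrite !xR yR.
Qed.

Lemma centerVl x y : center Q x -> center Q (x * y) -> center Q y.
Proof.
move=> /centerP[xC xL xR] /centerP[zC zL zR]; apply/centerP.
split=> [a|a b|a b].
- apply: (@mulgI x); rewrite -xR zC.
  by rewrite (xC y) xL xC.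
- apply: (@mulgI x).
  by rewrite [LHS]xC -!xL -!(xC y) zL (xC y) xL -xC.
- by apply: (@mulgI x); rewrite -!xR zR.
Qed.

End LoopTheory.

(** ** Normal subloops and quotients *)

Record normalSubloop (Q : loopType) := NormalSubloop {
  nsub_set :> set Q;
  nsub1 : nsub_set 1;
  nsubM : forall x y, nsub_set x -> nsub_set y -> nsub_set (x * y);
  nsub_ldiv : forall x y, nsub_set x -> nsub_set y -> nsub_set (LtransV x y);
  nsub_rdiv : forall x y, nsub_set x -> nsub_set y -> nsub_set (RtransV x y);
  nsub_inn : forall phi x, Inn Q phi -> nsub_set x -> nsub_set (phi x)
}.

Definition lcoset (Q : loopType) (N : set Q) (x : Q) : set Q :=
  [set x * n | n in N].

(* The carrier of the quotient is the type of left cosets [x N]. *)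
Definition quotient (Q : loopType) (N : normalSubloop Q) : Type :=
  set_type (range (lcoset N)).

Section Quotient.
Variables (Q : loopType) (N : normalSubloop Q).
Implicit Types (x y n : Q) (A B : quotient N).

HB.instance Definition _ :=
  Choice.copy (quotient N) (set_type (range (lcoset N))).

Definition qclass x : quotient N := SigSub (mem_set (imageT (lcoset N) x)).

Lemma quotient_surj A : exists x, A = qclass x.
Proof.
case: A => A PA; have [x _ Ax] := set_mem PA.
by exists x; apply: val_inj; rewrite /= Ax.
Qed.

Definition qrepr A : Q := sval (cid (quotient_surj A)).

Lemma qreprK A : qclass (qrepr A) = A.
Proof. by rewrite /qrepr; case: cid. Qed.

Definition quotient_mul A B : quotient N := qclass (qrepr A * qrepr B).
Definition quotient_one : quotient N := qclass 1.

Lemma nsub_innV phi x : Inn Q phi -> nsub_set N (phi x) -> nsub_set N x.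
Proof.
by move=> /inn_inv[psi [Ipsi fK _]] /(nsub_inn Ipsi); rewrite fK.
Qed.

Lemma nsub_innK phi n : Inn Q phi -> nsub_set N n ->
  exists2 m, nsub_set N m & phi m = n.
Proof.
by move=> /inn_inv[psi [Ipsi _ gK]] Nn; exists (psi n) => //; exact: nsub_inn.
Qed.

Lemma lcosetMl x y : lcoset N (x * y) = mul x @` lcoset N y.
Proof.
apply/seteqP; split=> [_ [n Nn <-]|_ [_ [n Nn <-] <-]].
  have [m Nm <-] := nsub_innK (inn_L_in y x) Nn.
  by rewrite inn_LE; exists (y * m) => //; exists m.
by rewrite -inn_LE; exists (inn_L y x n) => //;
  exact: nsub_inn (inn_L_in _ _) Nn.
Qed.

Lemma lcosetC x : lcoset N x = [set n * x | n in N].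
Proof.
apply/seteqP; split=> [_ [n Nn <-]|_ [n Nn <-]].
  have [m Nm <-] := nsub_innK (inn_T_in x) Nn.
  by rewrite inn_TE; exists m.
by rewrite -inn_TE; exists (inn_T x n) => //; exact: nsub_inn (inn_T_in _) Nn.
Qed.

Lemma lcosetMr x y : lcoset N (x * y) = mul^~ y @` lcoset N x.
Proof.
rewrite !lcosetC; apply/seteqP; split=> [_ [n Nn <-]|_ [_ [n Nn <-] <-]].
  have [m Nm <-] := nsub_innK (inn_R_in x y) Nn.
  by rewrite inn_RE; exists (m * x) => //; exists m.
by rewrite -inn_RE; exists (inn_R x y n) => //;
  exact: nsub_inn (inn_R_in _ _) Nn.
Qed.

Lemma lcoset_id n : nsub_set N n -> lcoset N n = N.
Proof.
move=> Nn; apply/seteqP; split=> [_ [m Nm <-]|m Nm]; first exact: nsubM.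
by exists (LtransV n m); [exact: nsub_ldiv|exact: LtransVK].
Qed.

Lemma lcoset_refl x : lcoset N x x.
Proof. by exists 1; [exact: nsub1|exact: mulg1]. Qed.

Lemma lcoset_eq x y : lcoset N x y -> lcoset N y = lcoset N x.
Proof. by move=> [n Nn <-]; rewrite lcosetMl lcoset_id. Qed.

Lemma qclassP x y : qclass x = qclass y <-> lcoset N x y.
Proof.
split=> [/(congr1 val)/= ->|/lcoset_eq xy]; first exact: lcoset_refl.
by apply: val_inj.
Qed.

Lemma qclassM x y : quotient_mul (qclass x) (qclass y) = qclass (x * y).
Proof.
apply: val_inj => /=.
have xx' := congr1 val (qreprK (qclass x)).
have yy' := congr1 val (qreprK (qclass y)).
by rewrite /= in xx' yy'; rewrite lcosetMl yy' -lcosetMl lcosetMr xx' -lcosetMr.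
Qed.

Lemma quotient_mul1 : left_id quotient_one quotient_mul.
Proof.
by move=> A; have [x ->] := quotient_surj A; rewrite qclassM mul1g.
Qed.

Lemma quotient_1mul : right_id quotient_one quotient_mul.
Proof.
by move=> A; have [x ->] := quotient_surj A; rewrite qclassM mulg1.
Qed.

HB.instance Definition _ := hasMul.Build (quotient N) quotient_mul.
HB.instance Definition _ :=
  Magma_isUMagma.Build (quotient N) quotient_mul1 quotient_1mul.

Lemma quotient_bijl A : bijective (fun B => A * B).
Proof.
have [x ->] := quotient_surj A.
exists (fun B => qclass (LtransV x (qrepr B))) => B.
  apply: etrans (qreprK B); apply/qclassP.
  have [y ->] := quotient_surj B.
  have : lcoset N (x * LtransV x (qrepr (qclass x * qclass y)))
                  (x * qrepr (qclass y)).
    by apply/qclassP; rewrite LtransVK qreprK -[RHS]qclassM qreprK.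
  by rewrite lcosetMl => -[z + /mulgI <-].
by rewrite [LHS]qclassM LtransVK qreprK.
Qed.

Lemma quotient_bijr A : bijective (fun B => B * A).
Proof.
have [x ->] := quotient_surj A.
exists (fun B => qclass (RtransV x (qrepr B))) => B.
  apply: etrans (qreprK B); apply/qclassP.
  have [y ->] := quotient_surj B.
  have : lcoset N (RtransV x (qrepr (qclass y * qclass x)) * x)
                  (qrepr (qclass y) * x).
    by apply/qclassP; rewrite RtransVK qreprK -[RHS]qclassM qreprK.
  by rewrite lcosetMr => -[z + /mulIg <-].
by rewrite [LHS]qclassM RtransVK qreprK.
Qed.

HB.instance Definition _ :=
  UMagma_isLoop.Build (quotient N) quotient_bijl quotient_bijr.

End Quotient.

(** ** Iterated centra *)

Section Preimage.
Variables (Q : loopType) (N : normalSubloop Q).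
Implicit Types x y : Q.

Local Notation cl := (qclass N).

(* The full preimage in [Q] of the center of [Q / N]. *)
Definition preim_center : set Q := cl @^-1` center (quotient N).

Local Lemma clM x y : cl (x * y) = cl x * cl y.
Proof. exact/esym/qclassM. Qed.

Local Lemma cl_ldiv x y : cl (LtransV x y) = LtransV (cl x) (cl y).
Proof. by apply: (@mulgI _ (cl x)); rewrite -clM !LtransVK. Qed.

Local Lemma cl_rdiv x y : cl (RtransV x y) = RtransV (cl x) (cl y).
Proof. by apply: (@mulIg _ (cl x)); rewrite /= -clM !RtransVK. Qed.

Local Definition liftable : set (Q -> Q) := [set f | bijective f /\
  exists2 g, Inn (quotient N) g & forall x, cl (f x) = g (cl x)].

Local Lemma perm_group_lift : perm_group liftable.
Proof.
have [_ I1 IM _] := InnP (quotient N).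
split=> [f []//|||].
- by split; [exists idfun|exists idfun].
- move=> f1 f2 [b1 [g1 Ig1 e1]] [b2 [g2 Ig2 e2]].
  split; first exact: bij_comp b2 b1.
  by exists (g1 \; g2) => [|x]; [exact: IM|rewrite /= e2 e1].
- move=> f f' [b [g Ig e]] fK f'K; split; first by exists f.
  have [g' [Ig' gK g'K]] := inn_inv Ig.
  by exists g' => // x; rewrite -{2}(f'K x) e gK.
Qed.

Local Lemma inn_lift phi : Inn Q phi ->
  exists2 g, Inn (quotient N) g & forall x, cl (phi x) = g (cl x).
Proof.
move=> Iphi; suff [] : liftable phi by [].
apply: Iphi; split; first exact: perm_group_lift.
move=> f gf; split; first exact: inn_generators_bij.
case: gf => [[a ->]|[a [b ->]]|[a [b ->]]].
- exists (inn_T (cl a)) => [|x]; first exact: inn_T_in.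
  by rewrite [LHS]cl_ldiv /Rtrans clM.
- exists (inn_L (cl a) (cl b)) => [|x]; first exact: inn_L_in.
  by rewrite [LHS]cl_ldiv /Ltrans !clM.
- exists (inn_R (cl a) (cl b)) => [|x]; first exact: inn_R_in.
  by rewrite [LHS]cl_rdiv /Rtrans !clM.
Qed.

Local Lemma zpre_1 : preim_center 1.
Proof. exact: center1. Qed.

Local Lemma zpre_M x y :
  preim_center x -> preim_center y -> preim_center (x * y).
Proof. by rewrite /preim_center /preimage /= clM; exact: centerM. Qed.

Local Lemma zpre_ldiv x y :
  preim_center x -> preim_center y -> preim_center (LtransV x y).
Proof.
by move=> Zx Zy; apply: (centerVl Zx); rewrite -clM LtransVK.
Qed.

Local Lemma zpre_rdiv x y :
  preim_center x -> preim_center y -> preim_center (RtransV x y).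
Proof.
move=> Zx Zy; apply: (centerVl Zx).
by have /centerP[-> _ _] := Zx; rewrite -clM RtransVK.
Qed.

Local Lemma zpre_inn phi x : Inn Q phi -> preim_center x -> preim_center (phi x).
Proof.
move=> /inn_lift[g Ig e] Zx; rewrite /preim_center /preimage /= e.
by rewrite (Zx g Ig).
Qed.

Definition center_preimage : normalSubloop Q :=
  @NormalSubloop Q preim_center
    zpre_1 zpre_M zpre_ldiv zpre_rdiv zpre_inn.

End Preimage.

Section Trivial.
Variable Q : loopType.

Local Lemma triv_M (x y : Q) : [set 1] x -> [set 1] y -> [set 1] (x * y).
Proof. by move=> -> ->; exact: mulg1. Qed.

Local Lemma triv_ldiv (x y : Q) :
  [set 1] x -> [set 1] y -> [set 1] (LtransV x y).
Proof. by move=> -> ->; apply: (@mulgI _ 1); rewrite LtransVK mulg1. Qed.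

Local Lemma triv_rdiv (x y : Q) :
  [set 1] x -> [set 1] y -> [set 1] (RtransV x y).
Proof. by move=> -> ->; apply: (@mulIg _ 1); rewrite /= RtransVK mulg1. Qed.

Local Lemma triv_inn phi (x : Q) : Inn Q phi -> [set 1] x -> [set 1] (phi x).
Proof. by move=> Iphi ->; exact: center1. Qed.

Definition trivial_subloop : normalSubloop Q :=
  @NormalSubloop Q [set 1] erefl triv_M triv_ldiv triv_rdiv triv_inn.

End Trivial.

Fixpoint iterated_center (Q : loopType) (i : nat) : normalSubloop Q :=
  if i is j.+1 then center_preimage (iterated_center Q j)
  else trivial_subloop Q.

Definition nilpotent_of_class (Q : loopType) (m : nat) : Prop :=
  iterated_center Q m = [set: Q] :> set Q /\
  forall k, (k < m)%N -> iterated_center Q k <> [set: Q] :> set Q.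

(** ** Moufang loops and divisibility *)

Definition moufang (Q : loopType) : Prop :=
  forall x y z : Q, x * (y * (x * z)) = ((x * y) * x) * z.

(* [y ^+ m] is the right-nested product [y * (y * (... * y))]; the bracketing is
   immaterial in a power-associative loop. *)
Definition uniquely_divisible (Q : loopType) (m : nat) : Prop :=
  forall x : Q, exists! y : Q, y ^+ m = x.

(* Main.v *)
Require Import Defs.
From mathcomp Require Import all_boot.
From mathcomp Require Import boolp classical_sets.

(** Write [T x] for conjugation by [x] and [[x, y]] for [x^-1 (x^y)].

    Commutators are nuclear.  The inverse of [T x] is a pseudo-automorphism with
    companion [x^3].  When two commuting pseudo-automorphisms are composed in
    both orders, the composite gets two companions, and these differ by an
    element of the nucleus.  For conjugations by [x] and [y] that element is a
    word in [x] and [y].  As conjugations commute, [[x, y]] commutes with [x]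
    and [y], and the word reduces to [[x^3, y]] ([comm_cube_nuclear]).  Every
    element is a cube, so all commutators are nuclear.

    Associators are nuclear.  Modulo the nucleus conjugations are thus trivial,
    so the companion identity says that the cubes, that is all elements,
    associate ([assoc_nuclear]).

    Associators are central.  If an automorphism [phi] in [Inn Q] maps [x] to
    [x n] with [n] nuclear, then [T (x n) = T x] because [Inn Q] is abelian, and
    this forces [n] to be central ([inner_automorphism_displacement]).  The
    mapping [inn_L x y] is an automorphism, its companion being a commutator and
    hence nuclear, and it displaces elements by associators.

    Commutators are central.  For nuclear [n], [T n] is an automorphism too, so
    [[a, n]] is central; it is multiplicative in [a], and so trivial when [a] is
    a commutator.  Comparing [T y (T x z)] with [T x (T y z)] gives
    [[[z, x], y] = [[z, y], x]], while exchanging [z] and [x] inverts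
    [[[z, x], y]].  Together these force the triple commutator to be its own
    inverse, hence trivial as there is no 2-torsion ([comm_comm1]).

    With commutators and associators in the center, the quotient by the center
    is an abelian group and the class is at most two. *)

Set Implicit Arguments.
Unset Strict Implicit.
Unset Printing Implicit Defensive.

Local Open Scope group_scope.

Definition loop_inv (Q : loopType) (x : Q) : Q := LtransV x 1.
Local Notation "x ^-1" := (loop_inv x) : group_scope.

Definition loop_comm (Q : loopType) (x y : Q) : Q := x^-1 * inn_T y x.
Local Notation "[~ x , y ]" := (loop_comm x y) : group_scope.

Definition cube (Q : loopType) (x : Q) : Q := x * (x * x).

Definition nuclear (Q : loopType) (n : Q) : Prop :=
  [/\ forall a b, n * (a * b) = (n * a) * b,
      forall a b, a * (n * b) = (a * n) * b
    & forall a b, a * (b * n) = (a * b) * n].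

(** * Moufang loops *)

Section MoufangBasics.
Variable Q : loopType.
Hypothesis Q_moufang : moufang Q.
Implicit Types a b c e x y z : Q.

Lemma loop_mulgV x : x * x^-1 = 1.
Proof. exact: LtransVK. Qed.

Lemma loop_mulKVg x y : x^-1 * (x * y) = y.
Proof.
by apply: (@Defs.mulgI _ x); rewrite Q_moufang loop_mulgV mul1g.
Qed.

Lemma loop_mulVg x : x^-1 * x = 1.
Proof. by rewrite -{2}(mulg1 x) loop_mulKVg. Qed.

Lemma loop_inv_eq x y : x * y = 1 -> x^-1 = y.
Proof. by move=> xy; apply: (@Defs.mulgI _ x); rewrite loop_mulgV xy. Qed.

Lemma loop_invK x : x^-1^-1 = x.
Proof. exact/loop_inv_eq/loop_mulVg. Qed.

Lemma loop_mulKg x y : x * (x^-1 * y) = y.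
Proof. by rewrite -{1}(loop_invK x) loop_mulKVg. Qed.

Lemma flexible x y : x * (y * x) = (x * y) * x.
Proof. by have := Q_moufang x y 1; rewrite !mulg1. Qed.

Lemma left_alternative x z : x * (x * z) = (x * x) * z.
Proof. by have := Q_moufang x 1 z; rewrite mul1g mulg1. Qed.

(** Every element has the form [x y], and the identity with [z] the inverse
    of [x] then says that right multiplication by that inverse undoes right
    multiplication by [x]. *)
Lemma loop_mulgK x y : (y * x) * x^-1 = y.
Proof.
rewrite -(loop_mulKg x y).
by rewrite -Q_moufang loop_mulgV mulg1.
Qed.

Lemma loop_mulgVK x y : (y * x^-1) * x = y.
Proof. by rewrite -{2}(loop_invK x) loop_mulgK. Qed.

Lemma loop_invM x y : (x * y)^-1 = y^-1 * x^-1.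
Proof.
have {1}<- : (x * y)^-1 * x = y^-1.
  by rewrite -{2}(loop_mulgK y x) loop_mulKVg.
by rewrite loop_mulgK.
Qed.

Lemma loop_inv_inj : injective (@loop_inv Q).
Proof. exact: can_inj loop_invK. Qed.

Lemma flexibleV x y : x^-1 * (y * x) = (x^-1 * y) * x.
Proof.
by apply: (@Defs.mulgI _ x); rewrite loop_mulKg flexible loop_mulKg.
Qed.

Lemma moufang_right x y z : ((z * x) * y) * x = z * (x * (y * x)).
Proof.
by apply: loop_inv_inj; rewrite !loop_invM Q_moufang.
Qed.

(** These say that [(x _ x, x^-1 _, x _)], [(_ x^-1, x _ x, _ x)] and
    [(x _, _ x, x _ x)] are autotopisms.  Words in two elements are rebracketed
    below through them alone, instead of through Moufang's theorem that two
    elements generate a group. *)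
Lemma autotopism_left x a b : x * (a * b) = (x * (a * x)) * (x^-1 * b).
Proof. by rewrite flexible -Q_moufang loop_mulKg. Qed.

Lemma autotopism_right x a b : (a * b) * x = (a * x^-1) * (x * (b * x)).
Proof. by rewrite -moufang_right loop_mulgVK. Qed.

Lemma autotopism_middle x a b : x * ((a * b) * x) = (x * a) * (b * x).
Proof.
rewrite flexible (autotopism_left x a) autotopism_right.
by rewrite flexible loop_mulgK flexible loop_mulKg.
Qed.

Lemma mul_cubel x z : cube x * z = x * (x * (x * z)).
Proof. by rewrite /cube flexible -Q_moufang. Qed.

Lemma mul_cuber x z : z * cube x = ((z * x) * x) * x.
Proof. by rewrite moufang_right. Qed.

Lemma cubeV x : cube x^-1 = (cube x)^-1.
Proof. by rewrite /cube !loop_invM flexible. Qed.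

Lemma inn_TV x a : inn_T x a = x^-1 * (a * x).
Proof. by apply: (@Defs.mulgI _ x); rewrite inn_TE loop_mulKg. Qed.

Definition conjV x a := x * (a * x^-1).

Lemma inn_TK x : cancel (inn_T x) (conjV x).
Proof.
by move=> a; rewrite /conjV inn_TV flexibleV loop_mulgK loop_mulKg.
Qed.

Lemma conjVK x : cancel (conjV x) (inn_T x).
Proof.
by move=> a; rewrite /conjV inn_TV flexibleV loop_mulKVg loop_mulgVK.
Qed.

Lemma inn_T_comm x y : inn_T y x = x * [~ x, y].
Proof. by rewrite /loop_comm loop_mulKg. Qed.

Lemma loop_commE x y k : inn_T y x = x * k -> [~ x, y] = k.
Proof. by move=> e; rewrite /loop_comm e loop_mulKVg. Qed.

Lemma inn_T_fixed x a : inn_T x a = a <-> a * x = x * a.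
Proof.
split=> [|h]; first by move=> {2}<-; rewrite inn_TE.
by apply: (@Defs.mulgI _ x); rewrite inn_TE.
Qed.

(** With [t = y^-1 x], one has [x^-1 = t^-1 y^-1]; this turns the right-hand
    side into [(t^-1 (y^-1 t)) y], on which the right autotopism of [y] acts. *)
Lemma loop_comm_left x y : [~ x, y] = (x^-1 * (y^-1 * x)) * y.
Proof.
rewrite /loop_comm inn_TV; set t := y^-1 * x.
have tV : t^-1 = x^-1 * y by rewrite loop_invM loop_invK.
have -> : x^-1 * t = t^-1 * (y^-1 * t).
  by rewrite flexibleV tV loop_mulgK.
by rewrite autotopism_right tV loop_mulgK flexible loop_mulKg flexibleV.
Qed.

Lemma loop_comm_shift x y : [~ y * x, x^-1] = (y * x)^-1 * (x * y).
Proof. by rewrite /loop_comm inn_TV loop_invK loop_mulgK. Qed.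

(** The right-hand side is itself a commutator, by the previous lemma, and
    rebracketing it as in [loop_comm_left] gives that form of [[~ x, y]]. *)
Lemma loop_comm_mid x y : [~ x, y] = (y * x)^-1 * (x * y).
Proof.
rewrite -loop_comm_shift.
rewrite [RHS]loop_comm_left loop_invK autotopism_right loop_invK loop_invM.
by rewrite (flexible x y) loop_mulgK loop_mulKVg loop_comm_left flexibleV.
Qed.

Lemma loop_commV x y : [~ x, y]^-1 = [~ y, x].
Proof. by rewrite !loop_comm_mid loop_invM loop_invK. Qed.

Lemma mul_comm x y : x * y = (y * x) * [~ x, y].
Proof. by rewrite loop_comm_mid loop_mulKg. Qed.

Lemma mul_comm_right x y : x * y = y * (x * [~ x, y]).
Proof. by rewrite -inn_T_comm inn_TE. Qed.

(** Both sides are [x y]. *)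
Lemma mulA_comm_left x y : y * (x * [~ x, y]) = (y * x) * [~ x, y].
Proof. by rewrite -mul_comm -mul_comm_right. Qed.

(** Cubing a conjugator cubes the conjugation, since [y] and its powers act
    on either side by commuting translations. *)
Lemma inn_T_cube y a : inn_T (cube y) a = inn_T y (inn_T y (inn_T y a)).
Proof.
apply: (@Defs.mulgI _ (cube y)); rewrite inn_TE mul_cubel inn_TE.
by rewrite flexible inn_TE flexible flexible inn_TE mul_cuber.
Qed.

End MoufangBasics.

(** * Nucleus and center *)

Section Nucleus.
Variable Q : loopType.
Implicit Types a b m n z w : Q.

Lemma nuclearM n m : nuclear n -> nuclear m -> nuclear (n * m).
Proof.
move=> [nl nm nr] [ml mm mr]; split=> a b.
- by rewrite -!nl ml.
- by rewrite -nl nm mm nm.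
- by rewrite !mr nr.
Qed.

Lemma nuclear_center n :
  nuclear n -> (forall a, n * a = a * n) -> center Q n.
Proof. by move=> [nl _ nr] nC; apply/centerP; split=> // a b; rewrite nl. Qed.

Lemma center_nuclear z : center Q z -> nuclear z.
Proof.
move=> /centerP[zC zr zl]; split=> // a b.
by rewrite (zC b) zr -!zC zl.
Qed.

Lemma centerC z a : center Q z -> z * a = a * z.
Proof. by move=> /centerP[]. Qed.

Lemma mulMM_center a b z w : center Q z -> center Q w ->
  (a * z) * (b * w) = (a * b) * (z * w).
Proof.
move=> Zz /center_nuclear[_ _ wr].
have [_ zm zr] := center_nuclear Zz.
by rewrite !wr -zm (centerC _ Zz) zr.
Qed.

Section MoufangNucleus.
Hypothesis Q_moufang : moufang Q.

(** Inversion turns the right nuclear identity for the inverse of [n] into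
    the left one for [n]; an autotopism attached to [n] then gives the middle
    one. *)
Lemma right_nuclear n : (forall a b, a * (b * n) = (a * b) * n) -> nuclear n.
Proof.
move=> nr.
have nVr a b : a * (b * n^-1) = (a * b) * n^-1.
  by apply: (@Defs.mulIg _ n); rewrite /= -nr !loop_mulgVK.
have nl a b : n * (a * b) = (n * a) * b.
  by apply: (loop_inv_inj Q_moufang); rewrite !loop_invM.
split=> // a b.
rewrite -(loop_mulKg Q_moufang n a); move: (n^-1 * a) => a'.
by rewrite -nl autotopism_left // loop_mulKVg // nl.
Qed.

Lemma nuclearV n : nuclear n -> nuclear n^-1.
Proof.
move=> [_ _ nr]; apply: right_nuclear => a b.
by apply: (@Defs.mulIg _ n); rewrite /= -nr !loop_mulgVK.
Qed.

End MoufangNucleus.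

End Nucleus.

(** * The center and quotients *)

Section CenterQuotient.
Variable Q : loopType.
Implicit Types x z : Q.

Lemma qclassMg (N : normalSubloop Q) x y :
  qclass N x * qclass N y = qclass N (x * y).
Proof. exact: qclassM. Qed.

Lemma center_quotient (N : normalSubloop Q) z :
    (forall a, qclass N (z * a) = qclass N (a * z)) ->
    (forall a b, qclass N (b * (a * z)) = qclass N ((b * a) * z)) ->
    (forall a b, qclass N ((z * a) * b) = qclass N (z * (a * b))) ->
  center (quotient N) (qclass N z).
Proof.
move=> zC zr zl; apply/centerP; split=> [A|A B|A B].
- by have [a ->] := quotient_surj A; rewrite !(qclassMg N _ _) zC.
- have [a ->] := quotient_surj A; have [b ->] := quotient_surj B.
  by rewrite (qclassMg N a z) !(qclassMg N b) (qclassMg N _ z) zr.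
- have [a ->] := quotient_surj A; have [b ->] := quotient_surj B.
  by rewrite (qclassMg N z a) !(qclassMg N _ b) (qclassMg N z) zl.
Qed.

Lemma center_iterated_center1 z :
  center Q z -> nsub_set (iterated_center Q 1) z.
Proof.
move=> /centerP[zC zr zl]; apply: center_quotient => [a|a b|a b].
- by rewrite zC.
- by rewrite zr.
- by rewrite zl.
Qed.

Lemma qclass_mul_center z x :
  center Q z -> qclass (iterated_center Q 1) (x * z) = qclass _ x.
Proof.
by move=> Zz; apply/esym/qclassP; exists z => //; exact: center_iterated_center1.
Qed.

End CenterQuotient.

(** * Commuting conjugations *)

Section CommutingConjugations.
Variable Q : loopType.
Hypothesis Q_moufang : moufang Q.
Hypothesis inn_TC : forall x y a : Q, inn_T x (inn_T y a) = inn_T y (inn_T x a).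
Implicit Types a b c e k s x y z : Q.

Lemma inn_T_id x : inn_T x x = x.
Proof. exact/inn_T_fixed. Qed.

Lemma inn_TV_fixed x a : inn_T x a = a -> inn_T x^-1 a = a.
Proof.
move=> /inn_T_fixed xa; apply/inn_T_fixed.
rewrite -{1}(loop_mulKVg Q_moufang x a) -xa.
by rewrite flexibleV // loop_mulgK.
Qed.

(** [x] and its conjugate by [y] commute because conjugation by [x] fixes
    [x] and commutes with conjugation by [y]. *)
Lemma comm_fixed_l x y : inn_T x [~ x, y] = [~ x, y].
Proof.
have /inn_T_fixed h : inn_T x (inn_T y x) = inn_T y x.
  by rewrite inn_TC inn_T_id.
by apply/inn_T_fixed; rewrite /loop_comm -flexibleV // h loop_mulKVg // loop_mulKg.
Qed.

Lemma inn_T_fixedV x a : inn_T x a = a -> inn_T x a^-1 = a^-1.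
Proof.
move=> xa; rewrite -[x](loop_invK Q_moufang); apply: inn_TV_fixed.
apply/inn_T_fixed; apply: (loop_inv_inj Q_moufang).
by rewrite !loop_invM // !loop_invK //; apply/esym/inn_T_fixed.
Qed.

(** As [[~ x, y]] is also the commutator of [y x] with [x^-1], it commutes with
    [y x], so [(x y) (y x)^-1] and [(y x)^-1 (x y)] coincide. *)
Lemma commVV x y : [~ x^-1, y^-1] = [~ x, y].
Proof.
have /inn_T_fixed h : inn_T (y * x) [~ x, y] = [~ x, y].
  by have := comm_fixed_l (y * x) x^-1; rewrite loop_comm_shift -?loop_comm_mid.
rewrite loop_comm_mid // loop_invM // !loop_invK // -loop_invM //.
rewrite (mul_comm Q_moufang x y) -h.
by rewrite loop_mulgK.
Qed.

(** The relation [x y = y (x [~ x, y])] for the inverses of [x] and [y], read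
    through inversion. *)
Lemma inn_T_mul_commV x y : inn_T y (x * [~ x, y]^-1) = x.
Proof.
apply: (@Defs.mulgI _ y); rewrite inn_TE.
have /inn_T_fixed <- := inn_T_fixedV (comm_fixed_l x y).
have := mul_comm_right Q_moufang x^-1 y^-1; rewrite commVV; set k := [~ x, y].
move=> /(congr1 (@loop_inv Q)).
by rewrite (loop_invM _ y^-1) // !(loop_invM _ x^-1) // !loop_invK // => ->.
Qed.

(** In a group this would be multiplicativity of conjugation.  Here the
    commutator of [x^y] with [y^-1] is the inverse of [[~ x, y]], and the
    previous lemma applied to [x^y] and [y^-1] is the claim. *)
Lemma inn_T_mul_comm x y : inn_T y (x * [~ x, y]) = (x * [~ x, y]) * [~ x, y].
Proof.
set k := [~ x, y]; set x' := x * k.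
have T'E a : inn_T y^-1 a = conjV y a.
  by rewrite inn_TV // loop_invK.
have x'V : [~ x', y^-1] = k^-1.
  apply: loop_commE => //; rewrite T'E /x' -inn_T_comm // inn_TK //.
  by rewrite inn_T_comm // loop_mulgK.
have := inn_T_mul_commV x' y^-1; rewrite x'V loop_invK // => e.
by rewrite -{1}e T'E conjVK.
Qed.

Lemma inn_T_mul2 y a e : inn_T y a = a * e -> inn_T y (a * e) = (a * e) * e.
Proof. by move=> /(loop_commE Q_moufang) <-; exact: inn_T_mul_comm. Qed.

Lemma comm_cube_r x y : [~ x, cube y] = cube [~ x, y].
Proof.
apply: loop_commE => //; rewrite inn_T_cube // mul_cuber //.
have T1 := inn_T_comm Q_moufang x y; have T2 := inn_T_mul2 T1.
by rewrite T1 T2 (inn_T_mul2 T2).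
Qed.

Lemma comm_cube_l x y : [~ cube x, y] = cube [~ x, y].
Proof.
by rewrite -loop_commV // comm_cube_r // -cubeV // loop_commV.
Qed.

(** Since [e] is the commutator of [a] and [y], it is also that of [y a] and
    [y], so that [mulA_comm_left] can be applied three times. *)
Lemma cube_mulA_comm y a e :
  inn_T y a = a * e -> cube y * (a * e) = (cube y * a) * e.
Proof.
have step b : inn_T y b = b * e ->
    y * (b * e) = (y * b) * e /\ inn_T y (y * b) = (y * b) * e.
  move=> /[dup] Tb /(loop_commE Q_moufang) be.
  have ybe : y * (b * e) = (y * b) * e by rewrite -be mulA_comm_left.
  split=> //; rewrite -ybe -Tb !inn_TV // -flexible //.
  by rewrite loop_mulKVg // loop_mulKg.
move=> /step[e1 /step[e2 /step[e3 _]]].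
by rewrite !mul_cubel // e1 e2 e3.
Qed.

(** This is [conjV x a * cube x], in the form in which the Moufang identities
    produce it. *)
Definition conjV_shift (x a : Q) : Q := x * ((a * x) * x).

(** The composite of the middle and right autotopisms of [x]: it makes [conjV x]
    a pseudo-automorphism with companion [cube x]. *)
Lemma conjV_companion x a b :
  conjV x a * conjV_shift x b = conjV_shift x (a * b).
Proof.
rewrite /conjV_shift (autotopism_right Q_moufang x a b).
by rewrite [RHS]autotopism_middle // (flexible Q_moufang x (b * x)).
Qed.

Lemma conjV_shiftE x a : conjV_shift x a = conjV x a * cube x.
Proof.
by rewrite -[in LHS](mulg1 a) -conjV_companion /conjV_shift mul1g.
Qed.

Lemma conjV_shift_inn_T x a : conjV_shift x a = cube x * inn_T x (inn_T x a).
Proof.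
by rewrite mul_cubel // inn_TE (flexible Q_moufang x) inn_TE.
Qed.

Lemma conjVC x y a : conjV x (conjV y a) = conjV y (conjV x a).
Proof.
apply: (can_inj (inn_TK Q_moufang x)); apply: (can_inj (inn_TK Q_moufang y)).
by rewrite conjVK // inn_TC !conjVK.
Qed.

(** The inverse conjugations [f] by [x] and [y] commute, so composing the two
    companion identities in both orders gives [f a * g b = g (a b)] for [g]
    either of the composed shifts.  Two such [g] differ by right multiplication
    by an element that associates on the right. *)
Lemma conjV_shiftC x y : exists2 s,
  (forall b, conjV_shift y (conjV_shift x b) =
             conjV_shift x (conjV_shift y b) * s)
  & forall a b, a * (b * s) = (a * b) * s.
Proof.
pose f a := conjV y (conjV x a).
pose g1 b := conjV_shift y (conjV_shift x b).
pose g2 b := conjV_shift x (conjV_shift y b).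
have fg1 a b : f a * g1 b = g1 (a * b) by rewrite /g1 -!conjV_companion.
have fg2 a b : f a * g2 b = g2 (a * b).
  by rewrite /f conjVC /g2 -!conjV_companion.
have f_surj b : exists a, b = f a.
  by exists (inn_T x (inn_T y b)); rewrite /f !inn_TK.
have shift_surj z b : exists a, b = conjV_shift z a.
  exists (inn_T z (b * (cube z)^-1)).
  by rewrite conjV_shiftE inn_TK // loop_mulgVK.
have g2_surj b : exists a, b = g2 a.
  by have [c ->] := shift_surj x b; have [a ->] := shift_surj y c; exists a.
have [b0 g2b0] := g2_surj 1.
have g12 b : g1 b = g2 b * g1 b0.
  have {1 2}-> : b = (b * b0^-1) * b0 by rewrite loop_mulgVK.
  by rewrite -fg1 -fg2 -g2b0 mulg1.
exists (g1 b0) => // a b.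
have [a' ->] := f_surj a; have [b' ->] := g2_surj b.
by rewrite fg2 -!g12 fg1.
Qed.

(** Write [X] and [Y] for the cubes and [e] for the commutator of [X] and [y].
    At the neutral element the two composed shifts are [Y X^yy = (Y X) e e] and
    [X Y^xx = (X Y) e^-1 e^-1 = (Y X) e], because [[~ X, Y] = e e e]; so the
    nuclear element by which they differ is [e]. *)
Lemma comm_cube_nuclear x y : nuclear [~ cube x, y].
Proof.
have [s sE /(right_nuclear Q_moufang)] := conjV_shiftC x y.
suff -> : [~ cube x, y] = s by [].
set e := [~ _, _].
have eV : [~ cube y, x] = e^-1.
  by rewrite loop_commV // comm_cube_r // comm_cube_l.
have TX := inn_T_comm Q_moufang (cube x) y; rewrite -/e in TX.
have TY := inn_T_comm Q_moufang (cube y) x; rewrite eV in TY.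
have XY : cube x * cube y = (((cube y * cube x) * e) * e) * e.
  by rewrite mul_comm // comm_cube_r mul_cuber.
have shift1 z : conjV_shift z 1 = cube z.
  by rewrite /conjV_shift mul1g.
have := sE 1; rewrite !shift1 !conjV_shift_inn_T TX (inn_T_mul2 TX).
rewrite TY (inn_T_mul2 TY).
rewrite (cube_mulA_comm (inn_T_mul2 TX)) (cube_mulA_comm TX).
rewrite (cube_mulA_comm (inn_T_mul2 TY)) (cube_mulA_comm TY) XY.
by rewrite !loop_mulgK // => /Defs.mulgI.
Qed.

End CommutingConjugations.

(** * Commuting inner mappings *)

Section AbelianInn.
Variable Q : loopType.
Hypothesis Q_moufang : moufang Q.
Hypothesis Q_div6 : uniquely_divisible Q 6.
Hypothesis Inn_abelian : commuting (Inn Q).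
Implicit Types a b c m n x y z : Q.

Lemma expg6 y : y ^+ 6 = cube (y * y).
Proof. by rewrite /cube -!left_alternative. Qed.

Lemma cube_surj x : exists y, x = cube y.
Proof. by have [y [<- _]] := Q_div6 x; exists (y * y); rewrite expg6. Qed.

(** Both [z] and [1] are sixth roots of [1]. *)
Lemma square_eq1 z : z * z = 1 -> z = 1.
Proof.
have [y [_ y1]] := Q_div6 1 => zz.
have <- : y = z by apply: y1; rewrite expg6 zz /cube !mulg1.
by apply: y1; rewrite expg1n.
Qed.

Lemma inn_TC x y a : inn_T x (inn_T y a) = inn_T y (inn_T x a).
Proof.
exact: (congr1 (@^~ a) (Inn_abelian (inn_T_in y) (inn_T_in x))).
Qed.

Lemma comm_nuclear x y : nuclear [~ x, y].
Proof. by have [z ->] := cube_surj x; apply: comm_cube_nuclear inn_TC _ _. Qed.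

Lemma nuclear_inn_T n c : nuclear n -> nuclear (inn_T c n).
Proof.
move=> Nn; rewrite inn_T_comm //.
by apply: nuclearM => //; exact: comm_nuclear.
Qed.

(** In [conjV x a * (conjV x b * c) = conjV x (a * b) * c], where [c] is the
    cube of [x], each conjugate is its argument times a nuclear element, and
    nuclear elements can be moved to the right end. *)
Lemma assoc_nuclear a b c :
  exists2 m, nuclear m & (a * b) * c = (a * (b * c)) * m.
Proof.
have [x ->] := cube_surj c; set c' := cube x.
have conj_n d : exists2 n, nuclear n & conjV x d = d * n.
  exists [~ d, x^-1]; first exact: comm_nuclear.
  by rewrite -inn_T_comm // inn_TV // loop_invK.
have [na Na ea] := conj_n a; have [nb Nb eb] := conj_n b.
have [nab Nab eab] := conj_n (a * b).
have := conjV_companion Q_moufang x a b.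
rewrite !conjV_shiftE // ea eb eab -/c'.
have [_ am ar] := Na; have [_ bm br] := Nb; have [_ abm abr] := Nab.
rewrite -bm -(inn_TE c' nb) -abm -(inn_TE c' nab).
have Nb' := nuclear_inn_T c' Nb; have Nab' := nuclear_inn_T c' Nab.
set nb' := inn_T c' nb in Nb' *; set nab' := inn_T c' nab in Nab' *.
have [_ bm' br'] := Nb'; have [_ abm' abr'] := Nab'.
rewrite br' -am br' -(inn_TE (b * c') na).
have Na' := nuclear_inn_T (b * c') Na; have [_ am' ar'] := Na'.
set na' := inn_T _ na in Na' am' ar' *.
rewrite br' ar' abr' => E.
exists (na' * (nb' * nab'^-1)).
  by do 2!apply: nuclearM => //; exact: nuclearV.
by rewrite am' bm' E loop_mulgK.
Qed.

(** For an automorphism [phi] in [Inn Q], conjugating the conjugation by [x]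
    gives the conjugation by [phi x = x n]. As [Inn Q] is abelian, [x] and
    [x n] induce the same conjugation, so [n] commutes with everything. *)
Lemma inner_automorphism_displacement phi x n :
    Inn Q phi -> {morph phi : a b / a * b} ->
  nuclear n -> phi x = x * n -> center Q n.
Proof.
move=> Iphi phiM Nn phix; apply: nuclear_center => // c.
have [_ nm nr] := Nn.
have [psi [_ _ psiK]] := inn_inv Iphi.
pose b := psi (conjV x c).
have phiT a : phi (inn_T x a) = inn_T x (phi a).
  exact: (congr1 (@^~ a) (Inn_abelian (inn_T_in x) Iphi)).
have Tb : phi (inn_T x b) = c by rewrite phiT psiK conjVK.
apply: (@Defs.mulgI _ x); rewrite nm -phix -Tb -phiM inn_TE phiM phix Tb.
by rewrite !nr psiK -(inn_TE x (conjV x c)) conjVK.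
Qed.

(** Composing left autotopisms exhibits [inn_L x y] as the third component of an
    autotopism [(U, V, inn_L x y)].  It is a pseudo-automorphism whose companion
    [V 1] is a commutator, and a pseudo-automorphism with a nuclear companion is
    an automorphism. *)
Lemma inn_L_morph x y : {morph inn_L x y : a b / a * b}.
Proof.
set w := y * x.
have LE z : inn_L x y z = w^-1 * (y * (x * z)).
  by apply: (@Defs.mulgI _ w); rewrite inn_LE loop_mulKg.
pose v := w * (y^-1 * x^-1).
pose U a := w^-1 * ((y * ((x * (a * x)) * y)) * w^-1).
pose V b := w * (y^-1 * (x^-1 * b)).
have UV a b : U a * V b = inn_L x y (a * b).
  rewrite LE (autotopism_left Q_moufang x) (autotopism_left Q_moufang y).
  by rewrite (autotopism_left Q_moufang w^-1) loop_invK.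
have [_ vm vr] : nuclear v.
  by have := comm_nuclear y^-1 x^-1; rewrite loop_comm_mid // loop_invM // !loop_invK.
have V1 : V 1 = v by rewrite /V mulg1.
have L1 : inn_L x y 1 = 1 by apply: center1; exact: inn_L_in.
have Uv a : U a * v = inn_L x y a by rewrite -V1 UV mulg1.
have VL b : V b = v * inn_L x y b.
  have U1 : U 1 = v^-1 by rewrite -[LHS](loop_mulgK Q_moufang v) Uv L1 mul1g.
  by rewrite -[in RHS](mul1g b) -UV U1 loop_mulKg.
by move=> a b; rewrite -UV VL vm Uv.
Qed.

Lemma inn_T_morph n : nuclear n -> {morph inn_T n : a b / a * b}.
Proof.
move=> [nl nm nr] a b; apply: (@Defs.mulgI _ n).
by rewrite inn_TE nl inn_TE -nm inn_TE nr.
Qed.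

(** The displacement of [c] by the automorphism [inn_L b a] is the associator. *)
Lemma assoc_center a b c :
  exists2 m, center Q m & a * (b * c) = ((a * b) * c) * m.
Proof.
have [m Nm e] := assoc_nuclear a b c.
have [_ _ mr] := nuclearV Q_moufang Nm.
have Lc : inn_L b a c = c * m^-1.
  apply: (@Defs.mulgI _ (a * b)); rewrite inn_LE mr e.
  by rewrite loop_mulgK.
exists m^-1; last by rewrite -inn_LE Lc mr.
apply: inner_automorphism_displacement (inn_L_in b a) (@inn_L_morph b a) _ Lc.
exact: nuclearV.
Qed.

Lemma comm_nuclear_center a n : nuclear n -> center Q [~ a, n].
Proof.
move=> Nn; apply: inner_automorphism_displacement (inn_T_in n) _ _ _.
- exact: inn_T_morph.
- exact: comm_nuclear.
- exact: inn_T_comm.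
Qed.

(** [a |-> [a, n]] is a homomorphism into the center, so it vanishes on
    commutators. *)
Lemma comm_nuclear_commute a b n : nuclear n -> n * [~ a, b] = [~ a, b] * n.
Proof.
move=> Nn; set m := [~ a, b]; apply/esym/inn_T_fixed.
have Zc c : center Q [~ c, n] by exact: comm_nuclear_center.
have := congr1 (inn_T n) (mul_comm Q_moufang a b); rewrite -/m.
rewrite (inn_T_morph Nn a b) (inn_T_morph Nn (b * a) m) (inn_T_morph Nn b a).
rewrite !(inn_T_comm Q_moufang _ n) (mulMM_center a b) // (mulMM_center b a) //.
rewrite (mulMM_center (b * a) m (centerM (Zc b) (Zc a)) (Zc m)).
rewrite -(mul_comm Q_moufang a b) => /Defs.mulgI.
rewrite (centerC _ (Zc b)) -{1}(mulg1 (_ * _)) => /Defs.mulgI <-.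
by rewrite mulg1.
Qed.

(** Conjugation by [y] is not an automorphism, but it is multiplicative on
    products with a nuclear factor. *)
Lemma inn_T_mulr_nuclear y z n :
  nuclear n -> inn_T y (z * n) = inn_T y z * inn_T y n.
Proof.
move=> Nn; apply: (@Defs.mulgI _ y).
have [_ nm _] := Nn; have [_ _ nr] := nuclear_inn_T y Nn.
by rewrite inn_TE -nm -(inn_TE y n) !nr inn_TE.
Qed.

Lemma comm_comm_center z x y : center Q [~ [~ z, x], y].
Proof.
apply: (centerVl (comm_nuclear_center y (comm_nuclear z x))).
by rewrite -loop_commV // loop_mulVg //; exact: center1.
Qed.

(** Conjugating [z] by [x] and then by [y] gives
    [z ([~ z, y] [~ z, x] [~ [~ z, x], y])].  The order of the two conjugations
    does not matter, and [[~ z, x]] and [[~ z, y]] commute. *)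
Lemma comm_commAC z x y : [~ [~ z, x], y] = [~ [~ z, y], x].
Proof.
have TT a b : inn_T b (inn_T a z) =
    z * (([~ z, b] * [~ z, a]) * [~ [~ z, a], b]).
  rewrite (inn_T_comm Q_moufang z a) inn_T_mulr_nuclear; last exact: comm_nuclear.
  rewrite !inn_T_comm //.
  have [_ bm _] := comm_nuclear z b; rewrite -bm.
  by have [_ _ ->] := center_nuclear (comm_comm_center z a b).
have := TT x y; rewrite inn_TC TT => /Defs.mulgI.
by rewrite (comm_nuclear_commute z y (comm_nuclear z x)) => /Defs.mulgI ->.
Qed.

Lemma comm_commV z x y : [~ [~ z, x], y] * [~ [~ x, z], y] = 1.
Proof.
have E : [~ z, x] * [~ x, z] = 1 by rewrite -(loop_commV Q_moufang z x) loop_mulgV.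
have := inn_T_mulr_nuclear y [~ z, x] (comm_nuclear x z).
rewrite E (center1 (inn_T_in y)) (inn_T_comm Q_moufang [~ z, x]).
rewrite (inn_T_comm Q_moufang [~ x, z]).
rewrite mulMM_center; [|exact: comm_comm_center|exact: comm_comm_center].
by rewrite E mul1g.
Qed.

(** The triple commutator is symmetric in its last two arguments and inverted
    by swapping the first two.  Going around the six permutations shows that
    it is its own inverse. *)
Lemma comm_comm1 z x y : [~ [~ z, x], y] = 1.
Proof.
pose D a b c := [~ [~ a, b], c].
have DC a b c : D a b c = D a c b by exact: comm_commAC.
have DV a b c : D b a c = (D a b c)^-1.
  by apply/esym/loop_inv_eq => //; exact: comm_commV.
apply: square_eq1.
have DD : D z x y = (D z x y)^-1.
  by rewrite [LHS]DC (DV y) (DC y) (DV x) loop_invK // (DC x) (DV z).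
by rewrite -/(D z x y) {1}DD loop_mulVg.
Qed.

Lemma comm_center x y : center Q [~ x, y].
Proof.
apply: nuclear_center => [|c]; first exact: comm_nuclear.
by apply/inn_T_fixed; rewrite inn_T_comm // comm_comm1 mulg1.
Qed.

Lemma iterated_center2 x : nsub_set (iterated_center Q 2) x.
Proof.
apply: center_quotient => [a|a b|a b].
- by rewrite (mul_comm Q_moufang x a) (qclass_mul_center _ (comm_center x a)).
- by have [m Zm ->] := assoc_center b a x; rewrite (qclass_mul_center _ Zm).
- by have [m Zm ->] := assoc_center x a b; rewrite (qclass_mul_center _ Zm).
Qed.

End AbelianInn.

Theorem theorem5p3 (Q : loopType)
  (Q_moufang : moufang Q)
  (Q_div6 : uniquely_divisible Q 6)
  (Inn_abelian : commuting (Inn Q)) :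
  exists m : nat, (m <= 2)%N /\ nilpotent_of_class Q m.
Proof.
pose full k := `[< iterated_center Q k = setT :> set Q >].
have full2 : full 2.
  by apply/asboolP/seteqP; split=> // x _; exact: iterated_center2.
have ex_full : exists k, full k by exists 2.
case: (ex_minnP ex_full) => m /asboolP fm m_min; exists m.
split; first exact: m_min.
by split=> // k km /asboolP /m_min; rewrite leqNgt km.
Qed.
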